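(* Let $G=(V,E)$ be a finite weighted graph with edge weights $\mu$, and let $\Omega\subset V$ be nonempty, such that $\widetilde{\Omega}$ is connected and $\delta\Omega$ has at least two vertices. Then $$h_J(\widetilde{\Omega})\leq h_E(\widetilde{\Omega}).$$
   Context: $V$ is a finite set and $\mu:V\times V\to[0,\infty)$, $(x,y)\mapsto\mu_{xy}=\mu_{yx}$, is a symmetric weight function; $\{x,y\}\in E$ (written $x\sim y$) iff $\mu_{xy}>0$. Self-loops are allowed. For $\Omega_1,\Omega_2\subset V$, $E(\Omega_1,\Omega_2)=\{\{x,y\}\in E: x\in\Omega_1,y\in\Omega_2\}$. For $F\subset E$, $\mu(F)=\sum_{\{x,y\}\in F}\mu_{xy}$. The vertex boundary is $\delta\Omega=\{x\in V\setminus\Omega: x\sim y\text{ for some }y\in\Omega\}$, and $\overline{\Omega}=\Omega\cup\delta\Omega$. The graph $\widetilde{\Omega}$ has vertex set $\overline{\Omega}$ and edge set $E(\Omega,\overline{\Omega})$. The measure $m:\overline{\Omega}\to(0,\infty)$ is $m_x=\sum_{y\in V,\,y\sim x}\mu_{xy}$ for $x\in\Omega$ and $m_x=\sum_{y\in\Omega,\,y\sim x}\mu_{xy}$ for $x\in\delta\Omega$; $m(A)=\sum_{x\in A}m_x$. For $A\subset\overline{\Omega}$, $\partial_\Omega A=E(A,V\setminus A)\cap E(\Omega,\overline{\Omega})$. The Escobar-type and Jammes-type Cheeger constants are $$h_E(\widetilde{\Omega})=\inf\left\{\frac{\mu(\partial_\Omega A)}{m(A\cap\delta\Omega)}: A\subset\overline{\Omega},\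 0<m(A\cap\delta\Omega)\le\tfrac12 m(\delta\Omega)\right\},$$ $$h_J(\widetilde{\Omega})=\inf\left\{\frac{\mu(\partial_\Omega A)}{m(A\cap\delta\Omega)}:A\subset\overline{\Omega},\ A\cap\delta\Omega\neq\emptyset,\ m(A)\le\tfrac12 m(\overline{\Omega})\right\}.$$ *)

(* Defs.v *)
From mathcomp Require Import all_boot all_order all_algebra.
From mathcomp Require Import all_classical all_reals ereal.

Set Implicit Arguments.
Unset Strict Implicit.
Unset Printing Implicit Defensive.

Import Order.TTheory GRing.Theory Num.Theory.
Local Open Scope ring_scope.

Section WeightedGraph.
Variables (R : realType) (V : finType) (mu : V -> V -> R).
Implicit Types (x y : V) (A Omega : {set V}) (e : {set V}) (F : {set {set V}}).

Definition adj : rel V := fun x y => 0 < mu x y.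

(* An edge is the unordered pair [set x; y], a self-loop being the singleton
   [set x; x] = [set x], so that every edge is counted once. *)
Definition edges_between (A B : {set V}) : {set {set V}} :=
  [set [set x; y] | x in A, y in B & adj x y]%SET.

(* The choice of the pair p representing e is immaterial when mu is
   symmetric: [set x; y] is only represented by (x, y) and (y, x). *)
Definition edge_weight e : R :=
  if [pick p : V * V | e == [set p.1; p.2]%SET] is Some p
  then mu p.1 p.2 else 0.

Definition edges_weight F : R := \sum_(e in F) edge_weight e.

Definition vbdry Omega : {set V} :=
  [set x | (x \notin Omega) && [exists y in Omega, adj x y]]%SET.

Definition vclos Omega : {set V} := Omega :|: vbdry Omega.

Definition tilde_edges Omega : {set {set V}} :=
  edges_between Omega (vclos Omega).

Definition tilde_adj Omega : rel V :=
  fun x y => [set x; y]%SET \in tilde_edges Omega.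

(* tilde_adj only relates vertices of vclos Omega, so paths between such
   vertices never leave vclos Omega. *)
Definition tilde_connected Omega : Prop :=
  {in vclos Omega &, forall x y, connect (tilde_adj Omega) x y}.

(* Only meaningful for x in vclos Omega. *)
Definition vmeas Omega x : R :=
  if x \in Omega then \sum_(y | adj y x) mu x y
  else \sum_(y in Omega | adj y x) mu x y.

Definition meas Omega A : R := \sum_(x in A) vmeas Omega x.

Definition edge_bdry Omega A : {set {set V}} :=
  edges_between A (~: A) :&: tilde_edges Omega.

Definition cheeger_ratio Omega A : R :=
  edges_weight (edge_bdry Omega A) / meas Omega (A :&: vbdry Omega).

Definition escobar_sets Omega : {set {set V}} :=
  [set A : {set V} | [&& A \subset vclos Omega,
     0 < meas Omega (A :&: vbdry Omega) &
     meas Omega (A :&: vbdry Omega) <= 2^-1 * meas Omega (vbdry Omega)]]%SET.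

Definition jammes_sets Omega : {set {set V}} :=
  [set A : {set V} | [&& A \subset vclos Omega,
     A :&: vbdry Omega != finset.set0 &
     meas Omega A <= 2^-1 * meas Omega (vclos Omega)]]%SET.

(* Infima in \bar R, so that the infimum of an empty family is +oo. *)
Definition h_E Omega : \bar R :=
  ereal_inf [set (cheeger_ratio Omega A)%:E | A in [set` escobar_sets Omega]]%classic.

Definition h_J Omega : \bar R :=
  ereal_inf [set (cheeger_ratio Omega A)%:E | A in [set` jammes_sets Omega]]%classic.

End WeightedGraph.

(* Main.v *)
Require Import Defs.
From mathcomp Require Import all_boot all_order all_algebra.
From mathcomp Require Import all_classical all_reals ereal.

(** If [A] is admissible for [h_E] and has at most half of the total measure, it
    is admissible for [h_J]. Otherwise its complement in the closure is: it has
    the same edge boundary, and at least as much mass on the vertex boundary, so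
    its ratio is no larger. *)

Import Order.TTheory GRing.Theory Num.Theory.
Local Open Scope ring_scope.

Section WeightedGraph.
Context {R : realType} {V : finType} {mu : V -> V -> R}.
Implicit Types (A B Omega : {set V}) (e : {set V}) (F : {set {set V}}).

Lemma meas_set0 Omega : meas mu Omega finset.set0 = 0.
Proof. by rewrite /meas big_set0. Qed.

Lemma measID Omega A B :
  meas mu Omega A = meas mu Omega (A :&: B) + meas mu Omega (A :\: B).
Proof. exact: big_setID. Qed.

(** Keeps the far endpoint of a boundary edge inside the closure, so that complements can be taken
    there instead of in [V]. *)
Lemma tilde_edge_sub {Omega e} :
  e \in tilde_edges mu Omega -> e \subset vclos mu Omega.
Proof.
case/imset2P => x y xO; rewrite inE => /andP[yO _] ->.
by rewrite finset.subUset !finset.sub1set yO andbT finset.in_setU xO.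
Qed.

Context (mu_ge0 : forall x y, 0 <= mu x y)
  (mu_sym : forall x y, mu x y = mu y x).

Lemma edges_weight_ge0 F : 0 <= edges_weight mu F.
Proof. by apply: sumr_ge0 => e _; rewrite /edge_weight; case: pickP. Qed.

(** An edge leaving [A] at [x] towards [y], read from [y] to [x], leaves the complement: [y] lies in
    the closure, and symmetry of [mu] keeps the pair adjacent. *)
Lemma edge_bdry_subD Omega A :
  edge_bdry mu Omega A \subset edge_bdry mu Omega (vclos mu Omega :\: A).
Proof.
apply/fintype.subsetP => e; rewrite !finset.in_setI => /andP[/imset2P[x y xA]].
rewrite !inE => /andP[yA xy] -> xyO; rewrite xyO andbT.
have := tilde_edge_sub xyO; rewrite finset.subUset !finset.sub1set => /andP[_ yO].
apply/imset2P; exists y x; last by rewrite finset.setUC.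
- by rewrite finset.in_setD yA.
- by rewrite inE finset.in_setC finset.in_setD xA /= /adj mu_sym.
Qed.

Lemma edge_bdryD Omega A : A \subset vclos mu Omega ->
  edge_bdry mu Omega (vclos mu Omega :\: A) = edge_bdry mu Omega A.
Proof.
move=> AO; apply/eqP; rewrite finset.eqEsubset edge_bdry_subD andbT.
(* Complementing twice gives back [A], as [A] lies in the closure; the remaining inclusion is then
   the previous lemma applied to the complement. *)
have {2}-> : A = vclos mu Omega :\: (vclos mu Omega :\: A).
  by rewrite finset.setDDr finset.setDv finset.set0U; apply/esym/finset.setIidPr.
exact: edge_bdry_subD.
Qed.

Lemma jammes_le_escobar {Omega A} : A \in escobar_sets mu Omega ->
  exists2 B, B \in jammes_sets mu Omega &
    cheeger_ratio mu Omega B <= cheeger_ratio mu Omega A.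
Proof.
set m := meas mu Omega; set dO := vbdry mu Omega; set cO := vclos mu Omega.
have mID B C : m B = m (B :&: C) + m (B :\: C) := measID _ _ _.
(* Turns the positive boundary mass of [h_E] into the nonempty boundary part of [h_J]. *)
have meas_neq0 B : 0 < m B -> B != finset.set0.
  by apply: contraTneq => ->; rewrite /m meas_set0 ltxx.
rewrite inE => /and3P[AO mA_gt0 mA_le].
have [mA_half|mA_half] := leP (m A) (2^-1 * m cO).
  by exists A => //; rewrite inE AO meas_neq0.
have half2 (x : R) : x = 2^-1 * x + 2^-1 * x by rewrite mulrC -splitr.
have mD_ge : m (A :&: dO) <= m ((cO :\: A) :&: dO).
  have -> : (cO :\: A) :&: dO = dO :\: A.
    by rewrite finset.setIDAC (finset.setIidPr _) // finset.subsetUr.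
  (* The bound [mA_le] serves twice: [A] has at most half of the mass of [dO], hence [dO :\: A] has
     at least half. *)
  apply: (le_trans mA_le); rewrite -(lerD2l (m (A :&: dO))).
  rewrite [leRHS](_ : _ = m dO); last by rewrite finset.setIC -mID.
  by rewrite [leRHS]half2 lerD2r.
have mD_gt0 := lt_le_trans mA_gt0 mD_ge.
exists (cO :\: A).
  rewrite inE finset.subsetDl meas_neq0 //=.
  (* Adding [m A] to both sides reduces the claim to [mA_half]. *)
  rewrite -(lerD2l (m A)) [leLHS](_ : _ = m cO); last first.
    by rewrite (mID cO A) (finset.setIidPr AO).
  by rewrite [leLHS]half2 lerD2r ltW.
rewrite /cheeger_ratio edge_bdryD //.
by rewrite ler_wpM2l ?edges_weight_ge0 // lef_pV2.
Qed.

End WeightedGraph.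

Theorem proposition4p1 (R : realType) (V : finType) (mu : V -> V -> R)
    (mu_ge0 : forall x y : V, (0 <= mu x y)%R)
    (mu_sym : forall x y : V, mu x y = mu y x)
    (Omega : {set V})
    (Omega_neq0 : Omega != finset.set0)
    (tildeOmega_connected : tilde_connected mu Omega)
    (bdry_ge2 : (2 <= #|vbdry mu Omega|)%N) :
  (h_J mu Omega <= h_E mu Omega)%E.
Proof.
(* It suffices that [h_J] bounds each Escobar ratio from below; with no Escobar set, [h_E] is
   [+oo]. *)
apply: le_ereal_inf_tmp => _ [A AE <-].
have [B BJ BA] := jammes_le_escobar mu_ge0 mu_sym AE.
apply: ge_ereal_inf; exists (cheeger_ratio mu Omega B)%:E; first by exists B.
by rewrite lee_fin.
Qed.
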